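(* Let $k\geq 1$, let $P_{2k+1}$ be the path with $2k+1$ vertices and let $H$ be a graph. Then the lexicographic product $P_{2k+1}[H]$ is traceable if and only if $(k+1)\pi(H)\geq |H|-1$ (equivalently, when $\pi(H)\geq 1$, $\left\lceil\frac{|H|-1}{\pi(H)}\right\rceil\leq k+1$).
   Context: The lexicographic product $G[H]$ has vertex set $V(G)\times V(H)$, with $(g,h)(g',h')$ an edge iff $gg'\in E(G)$, or $g=g'$ and $hh'\in E(H)$. $|H|$ is the number of vertices of $H$. $\pi(H)$ is the maximum number of edges of a spanning linear forest of $H$ (a forest whose components are paths). A graph is traceable if it has a hamiltonian path. *)

(* Defs.v *)
From HB Require Import structures.
From mathcomp Require Import all_boot all_order all_algebra.

Set Implicit Arguments.
Unset Strict Implicit.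
Unset Printing Implicit Defensive.

Record sgraph := SGraph {
  svertex :> finType;
  sedge : rel svertex;
  sedge_sym : symmetric sedge;
  sedge_irrefl : irreflexive sedge }.

Arguments sedge {s} _ _.

Definition path_rel n : rel 'I_n := fun i j => (i.+1 == j) || (j.+1 == i).

Lemma path_rel_sym n : symmetric (@path_rel n).
Proof. by move=> i j; rewrite /path_rel orbC. Qed.

Lemma path_rel_irrefl n : irreflexive (@path_rel n).
Proof. by move=> i; rewrite /path_rel orbb eqn_leq ltnn. Qed.

(* The path P_n: it has n vertices. *)
Definition path_graph n : sgraph := SGraph (@path_rel_sym n) (@path_rel_irrefl n).

Definition lex_rel (G H : sgraph) : rel (G * H) :=
  fun u v => sedge u.1 v.1 || (u.1 == v.1) && sedge u.2 v.2.

Lemma lex_rel_sym G H : symmetric (@lex_rel G H).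
Proof.
by move=> u v; rewrite /lex_rel sedge_sym eq_sym [sedge u.2 _]sedge_sym.
Qed.

Lemma lex_rel_irrefl G H : irreflexive (@lex_rel G H).
Proof. by move=> u; rewrite /lex_rel !sedge_irrefl andbF. Qed.

Definition lex_prod (G H : sgraph) : sgraph :=
  SGraph (@lex_rel_sym G H) (@lex_rel_irrefl G H).

Definition hamiltonian_path (G : sgraph) (s : seq G) : Prop :=
  [/\ sorted sedge s, uniq s & forall x : G, x \in s].

Definition traceable (G : sgraph) : Prop :=
  exists s : seq G, hamiltonian_path s.

Definition edge_set (G : sgraph) : {set {set G}} :=
  [set e | [exists x : G, exists y : G, sedge x y && (e == [set x; y])]].

Definition span_rel (G : sgraph) (F : {set {set G}}) : rel G :=
  fun x y => (x != y) && ([set x; y] \in F).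

Lemma span_rel_sym G F : symmetric (@span_rel G F).
Proof. by move=> x y; rewrite /span_rel eq_sym setUC. Qed.

Lemma span_rel_irrefl G F : irreflexive (@span_rel G F).
Proof. by move=> x; rewrite /span_rel eqxx. Qed.

(* The graph (V(G), F); a spanning subgraph of G when F \subset edge_set G. *)
Definition span_graph (G : sgraph) (F : {set {set G}}) : sgraph :=
  SGraph (@span_rel_sym G F) (@span_rel_irrefl G F).

Definition induced_rel (G : sgraph) (A : {set G}) : rel {x : G | x \in A} :=
  fun x y => sedge (val x) (val y).

Lemma induced_rel_sym G A : symmetric (@induced_rel G A).
Proof. by move=> x y; apply: sedge_sym. Qed.

Lemma induced_rel_irrefl G A : irreflexive (@induced_rel G A).
Proof. by move=> x; apply: sedge_irrefl. Qed.

Definition induced (G : sgraph) (A : {set G}) : sgraph :=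
  SGraph (@induced_rel_sym G A) (@induced_rel_irrefl G A).

Definition component (G : sgraph) (x : G) : {set G} :=
  [set y | connect sedge x y].

Definition graph_iso (G H : sgraph) : bool :=
  [exists f : {ffun G -> H},
    [&& injectiveb f, [forall y, exists x, f x == y]
      & [forall x, forall y, sedge (f x) (f y) == sedge x y]]].

(* Bounding the length of the cycle by #|G|, which makes the predicate
   boolean, loses nothing since a cycle has no repeated vertex: see forestP. *)
Definition is_forest (G : sgraph) : bool :=
  ~~ [exists n : 'I_#|G|.+1, exists s : n.-tuple G,
        (2 < n) && ucycleb sedge s].

Lemma forestP (G : sgraph) :
  reflect (forall s : seq G, ucycle sedge s -> size s <= 2) (is_forest G).
Proof.
apply: (iffP idP) => [/existsPn nC s Cs | nC].
  rewrite leqNgt; apply/negP => s_gt2; have /andP[_ Us] := Cs.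
  have lt_s : size s < #|G|.+1 by rewrite ltnS -(card_uniqP Us) max_card.
  have /existsPn/(_ (in_tuple s))/negP[] := nC (Ordinal lt_s).
  exact/andP.
apply/existsPn => n; apply/existsPn => s; apply/negP => /andP[n_gt2 /nC].
by rewrite size_tuple leqNgt n_gt2.
Qed.

Definition is_linear_forest (G : sgraph) : bool :=
  is_forest G &&
  [forall x : G, graph_iso (induced (component x)) (path_graph #|component x|)].

(* pi(H). *)
Definition max_linear_forest (H : sgraph) : nat :=
  \max_(F : {set {set H}} |
        (F \subset edge_set H) && is_linear_forest (span_graph F)) #|F|.

(* Main.v *)
Require Import Defs.
From mathcomp Require Import all_boot all_order all_algebra zify.

(** A linear forest with [c] edges is the same as an ordering of the vertices
    of [H] with [c] pairs of consecutive adjacent vertices, so [pi(H)] is the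
    maximum of that number over all orderings. Write [n = |H|], [p = pi(H)].

    Necessity: every edge of a hamiltonian path either touches one of the [k n]
    vertices of an odd layer (at most [2 k n] edges) or lies inside one of the
    [k + 1] even layers, where the path induces an ordering of [H] (at most [p]
    edges each). Hence [(2 k + 1) n - 1 <= 2 k n + (k + 1) p].

    Sufficiency: an ordering with [p] adjacencies can be cut into any number [c]
    of paths with [n - p <= c <= n]. So it suffices to find a walk on the path
    [P_(2k+1)] that visits each layer between [n - p] and [n] times, and to
    replace each visit by one of the pieces of the layer. The walk oscillates
    [f i] times between the layers [i] and [i + 1] before moving on, with
    [f (2 j + 1) = D j], [f (2 j) = n - 1 - D j] and
    [D j = min ((j + 1) p) (n - 1)]: odd layers are visited [n] times and the
    even layer [2 j] is visited [n - (D j - D (j - 1))] times. *)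

Set Implicit Arguments.
Unset Strict Implicit.
Unset Printing Implicit Defensive.

(** * Sequences and their consecutive related pairs *)

Section Adjacencies.
Variable T : eqType.
Implicit Types (r : rel T) (s : seq T).

Definition adjacencies r s := count (fun p => r p.1 p.2) (zip s (behead s)).

Lemma adjacencies_cons2 r x y s :
  adjacencies r (x :: y :: s) = r x y + adjacencies r (y :: s).
Proof. by []. Qed.

Lemma leq_adjacencies_cons r x s : adjacencies r s <= adjacencies r (x :: s).
Proof. by case: s => // y s; rewrite adjacencies_cons2 leq_addl. Qed.

Lemma leq_adjacencies_cat r s1 s2 :
  adjacencies r s1 + adjacencies r s2 <= adjacencies r (s1 ++ s2).
Proof.
elim: s1 => [|x [|y s1] IH] //; first exact: leq_adjacencies_cons.
by rewrite /= !adjacencies_cons2 -addnA leq_add2l.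
Qed.

Lemma size_sorted_adjacencies r s : sorted r s -> size s <= (adjacencies r s).+1.
Proof.
elim: s => [|x [|y s] IH] //= /andP[rxy ps].
by rewrite adjacencies_cons2 rxy; apply: IH.
Qed.

Lemma size_flatten_adjacencies r (ss : seq (seq T)) :
  all (sorted r) ss -> size (flatten ss) <= adjacencies r (flatten ss) + size ss.
Proof.
elim: ss => [|s ss IH] //= /andP[/size_sorted_adjacencies ss1 /IH sss].
have := leq_adjacencies_cat r s (flatten ss); rewrite size_cat; lia.
Qed.

(** Induction on [s]: the head becomes a block of its own when the tail can still be cut into [c.-1]
    blocks, and otherwise joins the first block of the tail. The first hypothesis says that [c] is
    at least the number of maximal sorted runs. *)
Lemma split_sorted_blocks r s c :
    size s <= adjacencies r s + c -> c <= size s ->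
  exists B : seq (seq T), [/\ flatten B = s, size B = c &
    all (fun b => (b != [::]) && sorted r b) B].
Proof.
elim: s c => [|x [|y s] IH] c.
- by case: c => // _ _; exists [::].
- by case: c => [|[|c]] // _ _; exists [:: [:: x]].
rewrite adjacencies_cons2 => c_ge c_le.
have [c1|c1] := leqP (size (y :: s)) (adjacencies r (y :: s) + c.-1).
  have c1le : c.-1 <= size (y :: s) by move: c_le => /=; lia.
  have [B [fB sB aB]] := IH _ c1 c1le.
  (* The predecessor truncates; [c = 0] is excluded because a nonempty sequence has fewer
     adjacencies than entries. *)
  have c0 : 0 < c.
    case: c c_ge c1 {c1le sB c_le} => // c_ge _.
    have : adjacencies r (y :: s) <= size s.
      apply: leq_trans (count_size _ _) _; rewrite size_zip /=; lia.
    by move: c_ge => /=; case: (r x y); lia.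
  exists ([:: x] :: B); split; rewrite /= ?fB ?sB ?prednK //.
have rxy : r x y by move: c_ge c1 => /=; case: (r x y); lia.
have cge : size (y :: s) <= adjacencies r (y :: s) + c.
  by move: c_ge => /=; rewrite rxy; lia.
have cle : c <= size (y :: s) by move: c_ge c1 c_le => /=; rewrite rxy; lia.
have [[|[|z b] B] [//= fB sB aB]] := IH _ cge cle.
case: fB => zy fB; subst z.
exists ((x :: y :: b) :: B); split => //=; first by rewrite fB.
by move: aB => /=; rewrite rxy.
Qed.

Lemma mem_zip_behead s a b : (a, b) \in zip s (behead s) -> a \in s /\ b \in s.
Proof.
elim: s => [|x [|y s] IH] //=; rewrite inE => /predU1P[[-> ->]|/IH[as_ bs]].
  by rewrite !inE !eqxx orbT.
by rewrite !in_cons in as_ bs *; rewrite as_ bs !orbT.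
Qed.

Lemma index_zip_behead s a b : uniq s -> (a, b) \in zip s (behead s) ->
  (index a s).+1 = index b s.
Proof.
elim: s => [|x [|y s] IH] //= /andP[xs us]; rewrite inE => /predU1P[[-> ->]|ps].
  by move: xs; rewrite eqxx inE negb_or => /andP[/negPf-> _]; rewrite eqxx.
have neq_x c : c \in y :: s -> (x == c) = false.
  by move=> cs; apply/negP => /eqP xc; rewrite xc cs in xs.
have [/neq_x-> /neq_x->] := mem_zip_behead ps.
by congr _.+1; apply: IH.
Qed.

End Adjacencies.

(** * Linear forests as orderings of the vertices *)

Definition ordering (T : finType) (s : seq T) := uniq s /\ forall x, x \in s.

Section RankedGraph.
Variables (G : sgraph) (rank : G -> nat).
Hypothesis rank_inj : injective rank.
Hypothesis rank_step :
  forall x y : G, sedge x y -> rank y = (rank x).+1 \/ rank x = (rank y).+1.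

(** Discrete intermediate values: ranks change by one along an edge, so a path cannot jump over a
    level. *)
Lemma edge_crossing (x y : G) r : connect sedge x y -> rank x <= r < rank y ->
  exists u v, [/\ connect sedge x u, sedge u v, rank u = r & rank v = r.+1].
Proof.
case/connectP => p; elim: p x => [|z p IH] x /=.
  by move=> _ -> /andP[xr rx]; have := leq_ltn_trans xr rx; rewrite ltnn.
move=> /andP[exz pz] yp /andP[xr ry].
have [zr|rz] := leqP (rank z) r.
  have [|u [v [zu uv ur vr]]] := IH z pz yp; first by rewrite zr.
  by exists u, v; split=> //; apply: connect_trans zu; apply: connect1.
exists x, z; split=> //; by case: (rank_step exz); lia.
Qed.

(** On a cycle, the two neighbours of a vertex of maximal rank would share the rank just below,
    against injectivity. In a component the ranks fill an interval, so subtracting the least one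
    gives an isomorphism onto a path. *)
Lemma ranked_is_linear_forest : is_linear_forest G.
Proof.
have csym := sym_connect_sym (@sedge_sym G).
apply/andP; split.
  apply/forestP => s cs; rewrite leqNgt; apply/negP => s2.
  have [x0 x0s] : exists x0, x0 \in s.
    by case: s s2 {cs} => // a s _; exists a; rewrite mem_head.
  case: (arg_maxnP (P := mem s) rank x0s) => x xs xmax.
  have [i s' rs] := rot_to xs.
  have cr : ucycle sedge (x :: s') by rewrite -rs rot_ucycle.
  have mr z : z \in s' -> rank z <= rank x.
    by move=> zs; apply: xmax; rewrite /= -(mem_rot i) rs inE zs orbT.
  have sz : size s = (size s').+1 by rewrite -(size_rot i) rs.
  case: s' {rs} cr mr sz => [|y s']; first by move=> _ _ sz; rewrite sz in s2.
  case/lastP: s' => [|s' z]; first by move=> _ _ sz; rewrite sz in s2.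
  move=> /andP[/= /andP[xy]]; rewrite !rcons_path last_rcons => /andP[_ zx].
  move=> /andP[_ /andP[yz _]] mr _.
  have := mr y (mem_head _ _); have := mr z.
  rewrite inE mem_rcons mem_head orbT => /(_ isT) rz ry.
  have eyz : y = z.
    by apply: rank_inj; case: (rank_step xy); case: (rank_step zx); lia.
  by move: yz; rewrite eyz mem_rcons mem_head.
apply/forallP => x; set C := component x.
have xC : x \in C by rewrite inE.
case: (arg_minnP (P := mem C) rank xC) => a aC amin'.
have amin (u : induced C) : rank a <= rank (val u) by apply: amin' (valP u).
have conC y z : y \in C -> z \in C -> connect sedge y z.
  by rewrite !inE => xy xz; apply: connect_trans xz; rewrite csym.
(* Every rank from that of [a] to that of [y] is attained in [C]. *)
have ltC y : y \in C -> rank y - rank a < #|C|.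
  move=> yC.
  have /subset_leq_card : [set: 'I_(rank y - rank a).+1] \subset
      [set inord (rank u - rank a) | u in C].
    apply/subsetP => r _; apply/imsetP; have ay := amin' _ yC.
    have [ry|ry] := eqVneq (r : nat) (rank y - rank a).
      by exists y => //; apply/val_inj; rewrite /= inordK ?ry.
    have rlt : rank a <= rank a + r < rank y.
      by have := ltn_ord r; move/eqP: ry; lia.
    have [u [v [au _ ur _]]] := edge_crossing (conC _ _ aC yC) rlt.
    exists u; first by rewrite !inE in aC *; apply: connect_trans au.
    by apply/val_inj; rewrite /= ur addKn inordK.
  by rewrite cardsT card_ord => /leq_trans/(_ (leq_imset_card _ _)).
apply/existsP.
exists [ffun u : induced C => Ordinal (ltC _ (valP u)) : path_graph #|C|].
set f := finfun _.
have finj : injective f.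
  move=> u v; rewrite !ffunE => /(congr1 val) /= e.
  move: (amin u) (amin v) => /= au av.
  apply/val_inj/rank_inj; rewrite /=; lia.
apply/and3P; split; first exact/injectiveP.
  have [|g _ gK] := inj_card_bij finj.
    by rewrite card_ord card_sig.
  by apply/forallP => i; apply/existsP; exists (g i); rewrite gK.
apply/forallP => u; apply/forallP => v; apply/eqP.
rewrite !ffunE /= /path_rel /induced_rel /=.
move: (amin u) (amin v) => /= au av.
(* A path from [b] to [c] has an edge climbing between their ranks, and by injectivity its ends are
   [b] and [c]. *)
have succ_edge b c : b \in C -> c \in C -> (rank b).+1 = rank c -> sedge b c.
  move=> bC cC bc.
  have [|b' [c' [_ bc' rb rc]]] := edge_crossing (r := rank b) (conC _ _ bC cC).
    by rewrite leqnn bc /=.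
  by rewrite -(rank_inj rb) -(rank_inj (etrans rc bc)).
apply/idP/idP => [/orP[]/eqP uv|/rank_step[] ->].
- by apply: succ_edge; rewrite ?(valP u) ?(valP v) //; lia.
- by rewrite sedge_sym; apply: succ_edge; rewrite ?(valP u) ?(valP v) //; lia.
- by rewrite subSn // eqxx.
- by rewrite subSn // eqxx orbT.
Qed.

End RankedGraph.

(** The counted pairs form a linear forest, ranked by position in [s]. *)
Lemma adjacencies_le_max_linear_forest (H : sgraph) (s : seq H) :
  ordering s -> adjacencies sedge s <= max_linear_forest H.
Proof.
case=> us as_.
pose D := [set p : H * H | sedge p.1 p.2 && ((index p.1 s).+1 == index p.2 s)].
pose F := [set [set p.1; p.2] | p in D].
have FP x y : [set x; y] \in F ->
    index y s = (index x s).+1 \/ index x s = (index y s).+1.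
  case/imsetP => -[a b]; rewrite inE /= => /andP[_ /eqP ab] xy.
  have := set21 a b; have := set22 a b; rewrite -xy !inE.
  case/pred2P=> bE; case/pred2P=> aE; subst; lia.
have cardF : adjacencies sedge s <= #|F|.
  rewrite card_in_imset => [|[a b] [c d]].
    rewrite /adjacencies -size_filter.
    have /card_uniqP <- : uniq [seq p <- zip s (behead s) | sedge p.1 p.2].
      by rewrite filter_uniq // zip_uniql.
    apply/subset_leq_card/subsetP => -[a b].
    rewrite mem_filter inE => /andP[-> ps] /=.
    by rewrite (index_zip_behead us ps) eqxx.
  (* Distinct pairs give distinct edges, because positions in [s] tell which end comes first. *)
  rewrite !inE /= => /andP[eab /eqP ab] /andP[ecd /eqP cd] E.
  have := set21 a b; have := set22 a b; rewrite E !inE.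
  case/pred2P=> bE; case/pred2P=> aE; subst; rewrite ?eqxx //; lia.
apply: leq_trans cardF _; apply: leq_bigmax_cond; apply/andP; split.
  apply/subsetP => e /imsetP[[a b]]; rewrite !inE /= => /andP[eab _] ->.
  by apply/existsP; exists a; apply/existsP; exists b; rewrite eab eqxx.
apply: (@ranked_is_linear_forest (span_graph F) (index^~ s)) => [x y e|x y].
  by rewrite -(nth_index x (as_ x)) e nth_index.
by move=> /andP[_ /FP].
Qed.

(** The isomorphism carries the enumeration of the path over to the component. By the last clause
    [index] gives each edge an earlier and a later end. *)
Lemma path_component_enum (G : sgraph) (x : G) :
    graph_iso (induced (component x)) (path_graph #|component x|) ->
  exists s : seq G, [/\ uniq s, s =i component x, sorted sedge s &
    {in component x &, forall u v, sedge u v ->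
       index v s = (index u s).+1 \/ index u s = (index v s).+1}].
Proof.
set C := component x.
case/existsP => f /and3P[/injectiveP finj /forallP fsurj /forallP fhom].
have [|g fK gK] := inj_card_bij finj; first by rewrite card_ord card_sig.
pose h := [fun i : 'I_#|C| => val (g i)].
have hinj : injective h by move=> i j /val_inj /(can_inj gK).
have hsurj u (uC : u \in C) : h (f (Sub u uC)) = u by rewrite /= fK.
have hhom i j : sedge (h i) (h j) = path_rel i j.
  by have /forallP/(_ (g j))/eqP := fhom (g i); rewrite !gK.
have hidx i : index (h i) [seq h i | i <- enum 'I_#|C|] = i.
  by rewrite index_map // index_enum_ord.
exists [seq h i | i <- enum 'I_#|C|]; split.
- by rewrite map_inj_uniq ?enum_uniq.
- move=> u; apply/mapP/idP => [[i _ ->]|uC]; first exact: (valP (g i)).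
  by exists (f (Sub u uC)); rewrite ?mem_enum ?hsurj.
- rewrite sorted_map (eq_sorted (e' := fun i j => path_rel i j)) //.
  apply: (@sub_sorted _ (relpre val (fun i j => i.+1 == j))) => [i j ij|].
    by apply/orP; left.
  rewrite -sorted_map val_enum_ord.
  by elim: (#|C|) 0 => [|[|n] IH] m //=; rewrite eqxx; apply: (IH m.+1).
move=> u v uC vC; rewrite -(hsurj u uC) -(hsurj v vC) hhom !hidx.
by case/orP => /eqP ->; auto.
Qed.

Lemma edge_set2 (G : sgraph) (u v : G) : ([set u; v] \in edge_set G) = sedge u v.
Proof.
rewrite inE; apply/existsP/idP => [[a /existsP[b /andP[ab /eqP uv]]]|uv].
  have := set21 a b; have := set22 a b; rewrite -uv !inE.
  case/pred2P=> bE; case/pred2P=> aE; subst; rewrite ?sedge_irrefl // in ab *.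
  by rewrite sedge_sym.
by exists u; apply/existsP; exists v; rewrite uv eqxx.
Qed.

(** The paths are laid end to end. With [c] components the ordering has at least [#|H| - c]
    adjacencies, while [F] has at most [#|H| - c] edges: an edge is determined by its later end,
    which is never first on its path. *)
Lemma linear_forest_ordering (H : sgraph) (F : {set {set H}}) :
    F \subset edge_set H -> is_linear_forest (span_graph F) ->
  exists2 s : seq H, ordering s & #|F| <= adjacencies sedge s.
Proof.
move=> FE /andP[_ /forallP lin]; set G := span_graph F in lin.
have csym := sym_connect_sym (@sedge_sym G).
have [S SP] := fin_all_exists (fun x => path_component_enum (lin x)).
have S_uniq x : uniq (S x) by case: (SP x).
have memS x y : (y \in S x) = connect (@sedge G) x y.
  by case: (SP x) => _ -> _ _; rewrite inE.
pose root := fingraph.root (@sedge G).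
have rootE x y : (root x == root y) = connect (@sedge G) x y.
  exact: root_connect.
have root_id x : roots (@sedge G) x -> root x = x by move/eqP.
have memSroot x y : (y \in S (root x)) = (root x == root y).
  by rewrite memS -rootE [root (root x)]root_root.
pose g x := index x (S (root x)).
have g_edge (u v : G) : sedge u v -> root u = root v /\
    (g v = (g u).+1 \/ g u = (g v).+1).
  move=> uv; have ruv : root u = root v by apply/eqP; rewrite rootE connect1.
  split=> //; rewrite /g -ruv.
  case: (SP (root u)) => _ eS _; apply=> //; rewrite -eS memSroot ?ruv //.
have g_inj u v : root u = root v -> g u = g v -> u = v.
  move=> ruv; rewrite /g -ruv => e.
  have uS : u \in S (root u) by rewrite memSroot.
  have vS : v \in S (root u) by rewrite memSroot ruv.
  by rewrite -(nth_index u uS) e nth_index.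
pose rs := enum (roots (@sedge G)).
pose s := flatten [seq S r | r <- rs].
have s_mem x : x \in s.
  apply/flatten_mapP; exists (root x); last by rewrite memSroot.
  by rewrite mem_enum; apply: roots_root.
have s_uniq : uniq s.
  rewrite /s {s s_mem}; have : {subset rs <= roots (@sedge G)} by move=> r; rewrite mem_enum.
  have : uniq rs by apply: enum_uniq.
  elim: rs => [|r t IH] //= /andP[rt ut] rst.
  rewrite cat_uniq S_uniq IH // => [|x xt]; last by rewrite rst // inE xt orbT.
  rewrite andbT; apply/hasPn => x /flatten_mapP[r' r't]; rewrite !memS => xr'.
  apply: contra rt => xr.
  have /eqP : root r' == root r by rewrite rootE (connect_trans xr') // csym.
  rewrite (root_id r) ?(root_id r') => [<- //||].
    by apply: rst; rewrite inE r't orbT.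
  by apply: rst; rewrite mem_head.
exists s; first by split.
have s_size : size s = #|H|.
  by rewrite -(card_uniqP s_uniq); apply: eq_card => x; rewrite s_mem.
have s_sorted : all (sorted (@sedge H)) [seq S r | r <- rs].
  apply/allP => _ /mapP[r _ ->]; case: (SP r) => _ _ + _.
  apply: sub_sorted => u v /andP[_ /(subsetP FE)].
  by rewrite edge_set2.
have := size_flatten_adjacencies s_sorted; rewrite -/s s_size size_map -cardE.
suff : #|F| + #|roots (@sedge G)| <= #|H| by lia.
pose Z := [set v : G | g v == 0].
have rZ : #|roots (@sedge G)| <= #|Z|.
  pose hd r := head r (S r).
  have hdS r : hd r \in S r.
    rewrite /hd; case E: (S r) => [|a t]; last exact: mem_head.
    by have := memS r r; rewrite E connect0.
  have root_hd r : roots (@sedge G) r -> root (hd r) = r.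
    by move=> rr; apply/eqP; rewrite eq_sym -{1}(root_id r rr) rootE -memS.
  rewrite -(card_in_image (f := hd)) => [|r r' /root_hd{2}<- /root_hd{2}<- ->] //.
  apply/subset_leq_card/subsetP => _ /imageP[r rr ->]; rewrite inE /g root_hd //.
  by have := hdS r; rewrite /hd; case: (S r) => //= a t; rewrite eqxx.
suff : #|F| <= #|~: Z| by have : #|Z| + #|~: Z| = #|H| := cardsC Z; lia.
(* The neighbour just before [v] on its path, with [v] itself as junk value; [g_inj] makes this
   neighbour unique, so an edge is recovered from its later end. *)
pose pre v := odflt v [pick u : G | sedge u v && ((g u).+1 == g v)].
apply: leq_trans (leq_imset_card (fun v => [set pre v; v]) _).
apply/subset_leq_card/subsetP => e eF.
have /(subsetP FE) := eF; rewrite inE.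
case/existsP => a /existsP[b /andP[ab /eqP eab]].
have nab : a != b by apply/eqP => ab'; rewrite ab' sedge_irrefl in ab.
have eG : @sedge G a b by rewrite /= /span_rel nab -eab.
have main u v : @sedge G u v -> g v = (g u).+1 ->
    [set u; v] \in [set [set pre v; v] | v in ~: Z].
  move=> uv gv; apply/imsetP; exists v; first by rewrite !inE gv.
  rewrite /pre; case: pickP => [w /andP[wv /eqP gw]|/(_ u)].
    rewrite /= (g_inj w u) //; last by apply/eqP; rewrite -eqSS gw gv.
    by rewrite (g_edge _ _ wv).1 (g_edge _ _ uv).1.
  by rewrite uv gv eqxx.
rewrite eab; case: (g_edge _ _ eG).2 => /main; first exact.
by rewrite setUC; apply; rewrite sedge_sym.
Qed.

Lemma ordering_max_linear_forest (H : sgraph) :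
  exists2 s : seq H, ordering s & max_linear_forest H <= adjacencies sedge s.
Proof.
rewrite /max_linear_forest.
case: (pickP (fun F : {set {set H}} =>
    (F \subset edge_set H) && is_linear_forest (span_graph F))) => [F0 F0P|noF].
  by rewrite (bigmax_eq_arg F0) //; case: arg_maxnP => // F /andP[] FE lin _;
    apply: linear_forest_ordering.
(* The maximum of an empty family is 0, so any ordering serves. *)
rewrite big_pred0 //; exists (enum H) => //.
by split=> [|x]; rewrite ?enum_uniq ?mem_enum.
Qed.

(** * Hamiltonian paths of a product from walks in the first factor *)

Lemma fill_walk (G H : sgraph) (w : seq G) (B : G -> seq (seq H)) :
    sorted sedge w -> (forall g, size (B g) = count_mem g w) ->
    (forall g, all (fun b => (b != [::]) && sorted sedge b) (B g)) ->
  exists t : seq (lex_prod G H), [/\ sorted sedge t,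
    ohead (map fst t) = ohead w &
    forall g h, count_mem (g, h) t = count_mem h (flatten (B g))].
Proof.
elim: w B => [|g w IH] B sw szB allB.
  exists [::]; split=> // g h; have /eqP := szB g; by rewrite size_eq0 => /eqP->.
pose B' g' := if g' == g then behead (B g') else B g'.
have szB' g' : size (B' g') = count_mem g' w.
  by have := szB g'; rewrite /B' /= eq_sym; case: eqP => [->|] //; rewrite size_behead => ->.
have allB' g' : all (fun b => (b != [::]) && sorted sedge b) (B' g').
  rewrite /B'; have := allB g'; case: eqP => // _; by case: (B g') => //= b bs /andP[].
have [t [st ht ct]] := IH B' (path_sorted sw) szB' allB'.
have := szB g; have := allB g; case EB: (B g) => [|b bs] /=; first by rewrite eqxx.
case: b EB => //= h0 b EB /andP[sb _] _.
exists ([seq (g, h) | h <- h0 :: b] ++ t); split=> //.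
  have sgb : path sedge ((g, h0) : lex_prod G H) [seq (g, h) | h <- b].
    rewrite path_map; apply: sub_path sb => h h' /= hh'.
    by rewrite /lex_rel /= eqxx hh' orbT.
  rewrite /= cat_path sgb; case: t st ht {ct} => [|v t] //= st.
  case: w sw {IH szB szB'} => //= g' w /andP[gg' _] [vg].
  by rewrite st andbT /lex_rel (last_map (fun h => (g, h))) /= vg gg'.
move=> g' h; rewrite count_cat ct count_map /B'.
have [->|ng] := eqVneq g' g.
  rewrite EB /= count_cat addnA; congr (_ + _ + _).
    by rewrite xpair_eqE eqxx.
  by apply: eq_count => h1; rewrite /= xpair_eqE eqxx.
rewrite (@eq_count _ _ pred0) ?count_pred0 // => h1.
by rewrite /= xpair_eqE eq_sym (negPf ng).
Qed.

Lemma walk_traceable (G H : sgraph) (w : seq G) :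
    sorted sedge w ->
    (forall g, #|H| <= max_linear_forest H + count_mem g w /\
               count_mem g w <= #|H|) ->
  traceable (lex_prod G H).
Proof.
move=> sw cw; have [s [us ms] ps] := ordering_max_linear_forest H.
have szs : size s = #|H|.
  by rewrite -(card_uniqP us); apply: eq_card => x; rewrite ms.
have splitG g : exists B : seq (seq H), [/\ flatten B = s,
    size B = count_mem g w & all (fun b => (b != [::]) && sorted sedge b) B].
  by apply: split_sorted_blocks; have := cw g; rewrite szs; lia.
have [B BP] := fin_all_exists splitG.
have [||t [st _ ct]] := @fill_walk G H w B sw.
- by move=> g; case: (BP g).
- by move=> g; case: (BP g).
have ct1 v : count_mem v t = 1.
  by case: v => g h; rewrite ct; case: (BP g) => -> _ _; rewrite count_uniq_mem ?ms.
have mt v : v \in t by rewrite -has_pred1 has_count ct1.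
exists t; split=> //; apply: count_mem_uniq => v; by rewrite ct1 mt.
Qed.

(** * Edge count over an independent set of layers *)

Section Independent.
Variables (G H : sgraph) (A : {set G}).
Hypothesis A_indep : {in A &, forall a b : G, ~~ sedge a b}.

Let inlayer g : rel (lex_prod G H) :=
  fun u v => [&& u.1 == g, v.1 == g & sedge u.2 v.2].

(** Neighbours in [t] that both lie in layer [g] stay neighbours when the other layers are filtered
    out; filtering may create further adjacencies. *)
Lemma adjacencies_layer g (t : seq (lex_prod G H)) :
  adjacencies (inlayer g) t <=
  adjacencies sedge [seq v.2 | v <- t & v.1 == g].
Proof.
elim: t => [|u [|v t] IH] //.
rewrite adjacencies_cons2 [inlayer g u v]/inlayer.
have [ug|nug] := boolP (u.1 == g); last by rewrite /= (negPf nug).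
have [vg|nvg] := boolP (v.1 == g).
  move: IH; rewrite /= ug vg /= adjacencies_cons2 leq_add2l; exact.
apply: leq_trans IH _; rewrite /= ug (negPf nvg) /=.
exact: leq_adjacencies_cons.
Qed.

(* The first vertex of the path has one neighbour only; the extra term on the
   left, which makes the induction work, records the edge it lacks. *)
Lemma size_path_independent (u : lex_prod G H) t :
  path sedge u t ->
  size t + (u.1 \notin A) <=
  \sum_(a in A) adjacencies (inlayer a) (u :: t) +
  2 * count (fun v => v.1 \notin A) (u :: t).
Proof.
elim: t u => [|v t IH] u; first by move=> _ /=; case: (_ \in _); lia.
move=> /= /andP[uv /IH] /=.
under [X in _ -> _ <= X + _]eq_bigr do rewrite adjacencies_cons2.
rewrite big_split /=.
(* If [u] is outside [A], its weight 2 pays for the new edge and the extra term. If only [v] is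
   outside, the extra term of the induction hypothesis pays for the edge. If both are inside,
   independence puts the edge within one layer. *)
have [uA|uA] := boolP (u.1 \in A); last by case: (v.1 \in A) => /=; lia.
have [vA|vA] := boolP (v.1 \in A); last by move=> /=; lia.
have uv1 : u.1 = v.1 /\ sedge u.2 v.2.
  by case/orP: uv => [uv|/andP[/eqP ? ?]] //; have := A_indep uA vA; rewrite uv.
have : 0 < \sum_(a in A) inlayer a u v.
  by rewrite (bigD1 u.1) //= /inlayer -uv1.1 eqxx uv1.2.
by move=> /=; lia.
Qed.

Lemma traceable_independent_bound : traceable (lex_prod G H) ->
  #|G| * #|H| - 1 <= #|A| * max_linear_forest H + 2 * (#|~: A| * #|H|).
Proof.
case=> t [st ut mt].
have szt : size t = #|G| * #|H|.
  by rewrite -card_prod -(card_uniqP ut); apply: eq_card => x; rewrite mt.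
have cnt : count (fun v => v.1 \notin A) t = #|~: A| * #|H|.
  rewrite -size_filter -(card_uniqP (filter_uniq _ ut)) -cardsT -cardsX.
  by apply: eq_card => v; rewrite mem_filter mt !inE !andbT.
(* As [t] is hamiltonian, its restriction to a layer projects to an ordering of [H]. *)
have lay : \sum_(a in A) adjacencies (inlayer a) t <= #|A| * max_linear_forest H.
  rewrite -sum_nat_const; apply: leq_sum => a _.
  apply: leq_trans (adjacencies_layer a t) _.
  apply: adjacencies_le_max_linear_forest; split.
    rewrite map_inj_in_uniq ?filter_uniq // => -[a1 h1] [a2 h2].
    by rewrite !mem_filter /= => /andP[/eqP-> _] /andP[/eqP-> _] ->.
  by move=> h; apply/mapP; exists (a, h); rewrite ?mem_filter ?eqxx ?mt.
case: t st {ut mt} szt cnt lay => [|u t] st szt cnt lay; first by rewrite -szt.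
have := size_path_independent st; rewrite cnt -szt subn1 [(size _).-1]/= => le1.
apply: leq_trans (leq_addr _ _) (leq_trans le1 _).
by rewrite leq_add2r.
Qed.

End Independent.

(** * Walks on a path with prescribed numbers of visits *)

(* The walk 0 (1 0)^(f 0) 1 (2 1)^(f 1) 2 ... m. *)
Fixpoint zigzag (f : nat -> nat) m : seq nat :=
  if m is i.+1 then
    zigzag f i ++ flatten (nseq (f i) [:: i.+1; i]) ++ [:: i.+1]
  else [:: 0].

Lemma last_zigzag f m : last 0 (zigzag f m) = m.
Proof. by case: m => // m; rewrite /= !last_cat. Qed.

Lemma zigzag_sorted f m :
  path (fun i j => (i.+1 == j) || (j.+1 == i)) 0 (behead (zigzag f m)) /\
  zigzag f m = 0 :: behead (zigzag f m).
Proof.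
elim: m => [|m [pm zm]] //=; have := last_zigzag f m; rewrite zm /= => lm.
split=> //; rewrite cat_path pm lm /= {pm zm lm}.
by elim: (f m) => [|n IH] /=; rewrite ?eqxx ?orbT.
Qed.

Lemma zigzag_leq f m i : i \in zigzag f m -> i <= m.
Proof.
elim: m => [|m IH] /=; first by rewrite inE => /eqP->.
rewrite !mem_cat => /or3P[/IH|/flattenP[? /nseqP[-> _]]|]; rewrite ?inE; lia.
Qed.

(** The terms are the visit on the way up, the oscillations with [i.+1] and those with [i.-1]. *)
Lemma count_zigzag f m i :
  count_mem i (zigzag f m) =
  (i <= m) + (if i < m then f i else 0) +
  (if 0 < i <= m then f i.-1 else 0).
Proof.
elim: m => [|m IH] /=; first by case: i.
have cnt n : count_mem i (flatten (nseq n [:: m.+1; m])) =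
    n * ((i == m.+1) + (i == m)).
  by elim: n => //= n ->; rewrite ![_ == i]eq_sym; lia.
rewrite !count_cat IH cnt /= [m.+1 == i]eq_sym.
have [->|ne_iS] := eqVneq i m.+1; first by rewrite /=; do !case: ifP; lia.
by have [->|ne_i] := eqVneq i m; do !case: ifP; lia.
Qed.

Lemma path_walk f m : exists2 w : seq (path_graph m.+1), sorted sedge w &
  forall i : 'I_m.+1, count_mem i w = count_mem (i : nat) (zigzag f m).
Proof.
exists (map inord (zigzag f m)).
  have [pz ez] := zigzag_sorted f m.
  rewrite sorted_map; apply: (@sub_in_sorted _ (mem (zigzag f m))
     (fun i j => (i.+1 == j) || (j.+1 == i))); last by rewrite ez.
    by move=> i j /zigzag_leq im /zigzag_leq jm; rewrite /= /path_rel !inordK.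
  exact/allP.
move=> i; rewrite count_map; apply: eq_in_count => j /zigzag_leq jm /=.
by rewrite -val_eqE /= inordK.
Qed.

(** * Traceability of the product with an odd path *)

Lemma traceable_path_lex k (H : sgraph) : 1 <= k ->
    #|H| - 1 <= (k + 1) * max_linear_forest H ->
  traceable (lex_prod (path_graph (2 * k + 1)) H).
Proof.
move=> k_ge1 Hp; have [H0|H_gt0] := posnP #|H|.
  (* An empty [H] is set apart because the visit counts below use a true [n - 1]. *)
  by exists [::]; split=> // -[i h]; have := max_card (pred1 h); rewrite H0 card1.
set p := max_linear_forest H in Hp *; set n := #|H| in Hp H_gt0 *.
pose D j := minn (j.+1 * p) (n - 1).
pose f i := if odd i then D i./2 else n - 1 - D i./2.
rewrite addn1; have [w sw cw] := path_walk f (2 * k).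
apply: (walk_traceable sw) => i; rewrite cw count_zigzag -/p -/n.
have := ltn_ord i; rewrite ltnS; move: (nat_of_ord i) => {w sw cw}{}i le_ik.
rewrite le_ik andbT.
have Dn j : D j <= n - 1 by rewrite geq_minr.
(* The hypothesis enters here: [D] reaches [n - 1] at [k], so the last layer, with nothing above it
   to oscillate with, is visited as if [f (2 * k)] were 0. *)
have Dk : D k = n - 1 by rewrite /D -addn1; lia.
have DS j : D j <= D j.+1 <= D j + p by rewrite /D; nia.
have D0 : D 0 <= p by rewrite /D; lia.
rewrite /f; have [oi|ei] := boolP (odd i).
  have [j ij] : exists j, i = j.*2.+1 by exists i./2; lia.
  rewrite ij /= uphalf_double doubleK odd_double /=.
  by have := Dn j; case: ifP; lia.
have [j ij] : exists j, i = j.*2 by exists i./2; lia.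
case: j ij => [|j] ij; subst i.
  by have := Dn 0; case: ifP => /=; lia.
rewrite doubleS /= odd_double /= doubleK uphalf_double.
have := Dn j; have := Dn j.+1; have := DS j.
case: ifP => /=; first lia.
by move=> h; have -> : j.+1 = k; rewrite ?Dk; lia.
Qed.

Lemma path_lex_bound k (H : sgraph) :
    traceable (lex_prod (path_graph (2 * k + 1)) H) ->
  #|H| - 1 <= (k + 1) * max_linear_forest H.
Proof.
pose A := [set i : path_graph (2 * k + 1) | ~~ odd i].
(* The ends of an edge of the path differ in parity. *)
have A_indep : {in A &, forall a b, ~~ sedge a b}.
  by move=> a b; rewrite !inE /= /path_rel; lia.
move=> /(traceable_independent_bound A_indep).
have cA : #|A| = k + 1.
  transitivity (\sum_(i < 2 * k + 1) ~~ odd i).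
    rewrite -sum1_card big_mkcond; apply: eq_bigr => i _.
    by rewrite inE; case: (odd i).
  elim: {A A_indep} k => [|k IH]; first by rewrite big_ord_recr big_ord0.
  have -> : 2 * k.+1 + 1 = (2 * k + 1).+2 by lia.
  by rewrite !big_ord_recr /= IH; lia.
have := cardsC A; rewrite cA card_ord => cA'.
have -> : #|~: A| = k by lia.
nia.
Qed.

Theorem theorem7 (k : nat) (k_ge1 : 1 <= k) (H : sgraph) :
  (traceable (lex_prod (path_graph (2 * k + 1)) H) <->
     #|H| - 1 <= (k + 1) * max_linear_forest H) /\
  (1 <= max_linear_forest H ->
     (traceable (lex_prod (path_graph (2 * k + 1)) H) <->
        (Num.ceil ((#|H|%:R - 1) / (max_linear_forest H)%:R : rat)
           <= (k + 1)%:Z)%R)).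
Proof.
have T : traceable (lex_prod (path_graph (2 * k + 1)) H) <->
    #|H| - 1 <= (k + 1) * max_linear_forest H.
  by split; [apply: path_lex_bound | apply: traceable_path_lex].
split=> // p_gt0; rewrite T.
rewrite Num.Theory.ceil_le_int Num.Theory.ler_pdivrMr ?Num.Theory.ltr0n //.
(* With the 1 moved to the right, both sides are naturals; this also covers an empty [H], where
   [#|H| - 1] truncates. *)
rewrite Num.Theory.lerBlDr -[X in (_ <= _ + X)%R]/(1%:R)%R.
rewrite -pmulrn -GRing.Theory.natrM -GRing.Theory.natrD.
by rewrite Num.Theory.ler_nat; split; lia.
Qed.
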